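(* Let $p$ be a prime and let $S \subseteq \mathbb{N}_0$ be a union of finitely many arithmetic progressions together with finitely many $p$-sets. Then there exist $k \in \mathbb{N}$, an endomorphism $\Phi$ of the split torus $X = \mathbb{G}_m^k$ over $K = \overline{\mathbb{F}_p}(t)$, a point $\alpha \in X(K)$ and a closed subvariety $V \subseteq X$ defined over $K$ such that $\{ n \in \mathbb{N}_0 : \Phi^n(\alpha) \in V(K) \} = S$.
   Context: $\mathbb{N}$ denotes the positive integers and $\mathbb{N}_0 = \mathbb{N} \cup \{0\}$. An arithmetic progression in $\mathbb{N}_0$ is a set $\{a + bt : t \in \mathbb{N}_0\}$ with $a, b \in \mathbb{N}_0$. For $m \in \mathbb{N}$, $c_1,\dots,c_m \in \mathbb{Q}\setminus\{0\}$, $k_1,\dots,k_m \in \mathbb{N}_0$ and a power $q$ of $p$, set $B(q; c_1,\dots,c_m; k_1,\dots,k_m) = \{ \sum_{j=1}^m c_j q^{k_j n_j} : n_j \in \mathbb{N}_0 \text{ for each } j\}$. A $p$-set is a subset of $\mathbb{N}_0$ of the form $B(p; c_1,\dots,c_m; k_1,\dots,k_m)$ for some such $m$, $c_j$, $k_j$. A variety is not assumed irreducible; an endomorphism of $X$ means a morphism $X \to X$ defined over $K$. *)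

(* Defs.v *)
From HB Require Import structures.
From mathcomp Require Import all_boot all_order all_algebra all_field.
From mathcomp Require Import fraction.
From mathcomp Require Import mpoly.
Set Implicit Arguments. Unset Strict Implicit. Unset Printing Implicit Defensive.
Import Order.TTheory GRing.Theory Num.Theory.
Local Open Scope ring_scope.

Definition Fpbar (p : nat) : countClosedFieldType :=
  projT1 (countable_algebraic_closure 'F_p).

Definition Kfield (p : nat) : fieldType := {fraction {poly Fpbar p}}.

Definition torus_point (F : fieldType) (k : nat) (x : 'I_k -> F) : Prop :=
  forall i, x i != 0.

Definition xprod (F : fieldType) (k : nat) : {mpoly F[k]} :=
  \prod_(i < k) 'X_i.

(** A Laurent polynomial in K[x_1^{+-1},...,x_k^{+-1}] (the coordinate ring
    of G_m^k) is represented by a pair (f, m) standing for f / (x_1...x_k)^m. *)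
Definition laurent (F : fieldType) (k : nat) := ({mpoly F[k]} * nat)%type.

Definition laurent_eval (F : fieldType) (k : nat) (f : laurent F k)
  (x : 'I_k -> F) : F :=
  (f.1).@[x] / (\prod_(i < k) x i) ^+ f.2.

Definition laurent_unit (F : fieldType) (k : nat) (f : laurent F k) : Prop :=
  exists g : laurent F k, f.1 * g.1 = xprod F k ^+ (f.2 + g.2).

(** An endomorphism (morphism over F) of G_m^k = Spec F[x^{+-1}] is given by
    a ring endomorphism of F[x^{+-1}] over F, i.e. by the images of the
    coordinates x_i, which must be units of F[x^{+-1}]. *)
Record torus_endo (F : fieldType) (k : nat) := TorusEndo {
  endo_coord : 'I_k -> laurent F k;
  endo_unit : forall i, laurent_unit (endo_coord i) }.

Definition endo_apply (F : fieldType) (k : nat) (Phi : torus_endo F k)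
  (x : 'I_k -> F) : 'I_k -> F :=
  fun i => laurent_eval (endo_coord Phi i) x.

(** A closed subvariety V of G_m^k is the zero locus of finitely many
    regular functions; its F-points are the torus points where they all vanish.
    (Laurent polynomials f / (x_1...x_k)^m and f have the same zero locus on
    the torus, so polynomial equations suffice.) *)
Definition in_subvariety (F : fieldType) (k : nat) (eqs : seq {mpoly F[k]})
  (x : 'I_k -> F) : Prop :=
  torus_point x /\ forall f, f \in eqs -> f.@[x] = 0.

Definition in_AP (a b : nat) (n : nat) : Prop := exists t : nat, n = (a + b * t)%N.

Definition in_B (p m : nat) (c : 'I_m -> rat) (kk : 'I_m -> nat) (x : rat) : Prop :=
  exists nn : 'I_m -> nat, x = \sum_(j < m) c j * (p%:Q) ^+ (kk j * nn j).

(** T is a p-set: T = B(p; c; k) for some m >= 1, nonzero rationals c_j and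
    k_j in N_0 (in particular B(p; c; k) consists of nonnegative integers). *)
Definition is_pset (p : nat) (T : nat -> Prop) : Prop :=
  exists (m : nat) (c : 'I_m -> rat) (kk : 'I_m -> nat),
    (0 < m)%N /\ (forall j, c j != 0) /\
    forall x : rat, in_B p c kk x <-> exists n : nat, T n /\ x = n%:Q.

(* Main.v *)
(** Call a set of n definable when it is the vanishing locus, along an orbit of a
    self-map [x_i |-> c_i x_(g i)] of a torus, of finitely many polynomials. These
    sets are closed under finite unions and intersections and include the
    eventually periodic ones, so only p-sets matter. Clearing denominators, cutting
    exponents into residues modulo a large K and multiplying by a power of p, a
    p-set is reduced to the condition M = \sum_j e_j q^(s_j), where q = p^K,
    E = \sum_j e_j is less than q / p, and M is an affine function of n.

    To test it, interpolate x |-> (x - t)^M on F_q by a polynomial f of degree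
    less than q. The coefficient of x^l in f is a sum of distinct powers of t
    times the binomials 'C(M, b) with b reducing to l modulo q - 1, so f has degree
    at most E exactly when M is a sum of at most E powers of q, and then f is the
    product of the corresponding factors x - t^(q^s). That the roots of f can be
    grouped into blocks of equal roots of sizes e_j is a closed condition on its
    coefficients, by the theorem on symmetric polynomials. *)

Require Import Defs.
From HB Require Import structures.
From mathcomp Require Import all_boot all_order all_algebra all_field.
From mathcomp Require Import fingroup perm fraction.
From mathcomp Require Import mpoly.
From mathcomp Require Import zify ring.
Import Order.TTheory GRing.Theory Num.Theory.
Local Open Scope ring_scope.

Set Implicit Arguments. Unset Strict Implicit. Unset Printing Implicit Defensive.

(** * Sets definable along monomial orbits *)

(* The self-maps [x_i |-> c_i x_(g i)] of the torus. *)
Record monsys (F : fieldType) := MonSys {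
  ms_dim : nat;
  ms_coef : 'I_ms_dim -> F;
  ms_node : 'I_ms_dim -> 'I_ms_dim;
  ms_start : 'I_ms_dim -> F;
  ms_coef_neq0 : forall i, ms_coef i != 0;
  ms_start_neq0 : forall i, ms_start i != 0 }.

Definition ms_step (F : fieldType) (s : monsys F) (x : 'I_(ms_dim s) -> F) :=
  fun i => ms_coef i * x (ms_node i).

Definition ms_orbit (F : fieldType) (s : monsys F) (n : nat) :=
  iter n (@ms_step F s) (@ms_start F s).
Arguments ms_orbit [F] s n _.

Lemma ms_orbitS (F : fieldType) (s : monsys F) n i :
  ms_orbit s n.+1 i = ms_coef i * ms_orbit s n (ms_node i).
Proof. by []. Qed.

Lemma ms_orbit_neq0 (F : fieldType) (s : monsys F) n i : ms_orbit s n i != 0.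
Proof.
elim: n i => [|n IHn] i; first exact: ms_start_neq0.
by rewrite ms_orbitS mulf_neq0 ?ms_coef_neq0.
Qed.

Definition carried (F : fieldType) (s : monsys F) (u : nat -> F) :=
  exists P : {mpoly F[ms_dim s]}, forall n, u n = P.@[ms_orbit s n].

(** The two systems run side by side on disjoint coordinates, and polynomials are pulled back along
    the two projections. *)
Lemma monsys_pair (F : fieldType) (s1 s2 : monsys F) :
  exists s : monsys F, (ms_dim s = ms_dim s1 + ms_dim s2)%N /\
    forall u, carried s1 u \/ carried s2 u -> carried s u.
Proof.
pose co T (f1 : 'I_(ms_dim s1) -> T) (f2 : 'I_(ms_dim s2) -> T) i :=
  match split i with inl a => f1 a | inr b => f2 b end.
have coP (f1 : 'I_(ms_dim s1) -> F) (f2 : 'I_(ms_dim s2) -> F) :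
    (forall i, f1 i != 0) -> (forall i, f2 i != 0) -> forall i, co F f1 f2 i != 0.
  by move=> f1P f2P i; rewrite /co; case: (split i).
pose g := co _ (fun a => lshift (ms_dim s2) (ms_node a))
               (fun b => rshift (ms_dim s1) (ms_node b)).
pose s := MonSys g (coP _ _ (@ms_coef_neq0 F s1) (@ms_coef_neq0 F s2))
                   (coP _ _ (@ms_start_neq0 F s1) (@ms_start_neq0 F s2)).
have col T f1 f2 a : co T f1 f2 (lshift _ a) = f1 a.
  by rewrite /co -[lshift _ _]/(unsplit (inl a)) unsplitK.
have cor T f1 f2 b : co T f1 f2 (rshift _ b) = f2 b.
  by rewrite /co -[rshift _ _]/(unsplit (inr b)) unsplitK.
have orbl n a : ms_orbit s n (lshift _ a) = ms_orbit s1 n a.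
  by elim: n a => [|n IHn] a; rewrite ?ms_orbitS /= ?{1}/g ?col ?IHn.
have orbr n b : ms_orbit s n (rshift _ b) = ms_orbit s2 n b.
  by elim: n b => [|n IHn] b; rewrite ?ms_orbitS /= ?{1}/g ?cor ?IHn.
exists s; split=> // u [[P uP]|[P uP]].
  exists (P \mPo [tuple 'X_(lshift (ms_dim s2) a) | a < ms_dim s1]) => n.
  rewrite uP comp_mpoly_meval; apply: meval_eq => a.
  by rewrite tnth_mktuple mevalXU orbl.
exists (P \mPo [tuple 'X_(rshift (ms_dim s1) b) | b < ms_dim s2]) => n.
rewrite uP comp_mpoly_meval; apply: meval_eq => b.
by rewrite tnth_mktuple mevalXU orbr.
Qed.

(** [orbseq_iter] supplies the eventually periodic sequences and [orbseq_geom] the exponential ones;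
    [orbseq_ext] allows pointwise rewriting without function extensionality. *)
Inductive orbseq (F : fieldType) : (nat -> F) -> Prop :=
| orbseq_const c : orbseq (fun=> c)
| orbseq_geom a c : a != 0 -> c != 0 -> orbseq (fun n => a * c ^+ n)
| orbseq_iter k (g : 'I_k -> 'I_k) (al : 'I_k -> F) i :
    (forall j, al j != 0) -> orbseq (fun n => al (iter n g i))
| orbseq_add u v : orbseq u -> orbseq v -> orbseq (fun n => u n + v n)
| orbseq_mul u v : orbseq u -> orbseq v -> orbseq (fun n => u n * v n)
| orbseq_ext u v : u =1 v -> orbseq u -> orbseq v.

Lemma orbseq_sum (F : fieldType) (I : Type) (r : seq I) (u : I -> nat -> F) :
  (forall i, orbseq (u i)) -> orbseq (fun n => \sum_(i <- r) u i n).
Proof.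
move=> uP; elim: r => [|i r IHr].
  by apply: (orbseq_ext _ (orbseq_const 0)) => n; rewrite big_nil.
by apply: (orbseq_ext _ (orbseq_add (uP i) IHr)) => n; rewrite big_cons.
Qed.

Lemma orbseq_prod (F : fieldType) (I : Type) (r : seq I) (u : I -> nat -> F) :
  (forall i, orbseq (u i)) -> orbseq (fun n => \prod_(i <- r) u i n).
Proof.
move=> uP; elim: r => [|i r IHr].
  by apply: (orbseq_ext _ (orbseq_const 1)) => n; rewrite big_nil.
by apply: (orbseq_ext _ (orbseq_mul (uP i) IHr)) => n; rewrite big_cons.
Qed.

Lemma orbseq_exp (F : fieldType) (u : nat -> F) e :
  orbseq u -> orbseq (fun n => u n ^+ e).
Proof.
move=> uP; elim: e => [|e IHe].
  by apply: (orbseq_ext _ (orbseq_const 1)) => n; rewrite expr0.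
by apply: (orbseq_ext _ (orbseq_mul uP IHe)) => n; rewrite exprS.
Qed.

Lemma orbseq_meval (F : fieldType) k (P : {mpoly F[k]}) (u : 'I_k -> nat -> F) :
  (forall i, orbseq (u i)) -> orbseq (fun n => P.@[fun i => u i n]).
Proof.
move=> uP; have: orbseq (fun n => \sum_(m <- msupp P)
    P@_m * \prod_(i <- index_enum 'I_k) u i n ^+ m i).
  apply: orbseq_sum => m; apply: orbseq_mul; first exact: orbseq_const.
  by apply: orbseq_prod => i; apply: orbseq_exp.
by apply: orbseq_ext => n; rewrite mevalE.
Qed.

Lemma orbseq_carried (F : fieldType) (u : nat -> F) :
  orbseq u -> exists s : monsys F, carried s u.
Proof.
elim=> {u} [c|a c a0 c0|k g al i al0|u v _ [s1 su] _ [s2 sv]|u v _ [s1 su] _ [s2 sv]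
  |u v uv _ [s [P uP]]].
- exists (@MonSys F 0 (fun=> 0) id (fun=> 0) (ltac:(by case)) (ltac:(by case))).
  by exists c%:MP => n; rewrite mevalC.
- pose s := @MonSys F 1 (fun=> c) id (fun=> a) (fun=> c0) (fun=> a0).
  exists s, 'X_ord0 => n; rewrite mevalXU.
  elim: n => [|n IHn]; first by rewrite mulr1.
  by rewrite ms_orbitS /= -IHn exprS mulrCA.
- pose s := @MonSys F k (fun=> 1) g al (fun=> oner_neq0 F) al0.
  exists s, 'X_i => n; rewrite mevalXU.
  elim: n i => [|n IHn] i //.
  by rewrite ms_orbitS /= mul1r -IHn -iterSr.
- have [s [_ sP]] := monsys_pair s1 s2.
  have [[P uP] [P' vP]] := (sP u (or_introl su), sP v (or_intror sv)).
  by exists s, (P + P') => n; rewrite mevalD uP vP.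
- have [s [_ sP]] := monsys_pair s1 s2.
  have [[P uP] [P' vP]] := (sP u (or_introl su), sP v (or_intror sv)).
  by exists s, (P * P') => n; rewrite mevalM uP vP.
- by exists s, P => n; rewrite -uv.
Qed.

Lemma orbseq_family_carried (F : fieldType) (I : Type) (r : seq I)
    (u : I -> nat -> F) :
  (forall i, orbseq (u i)) ->
  exists s : monsys F, (0 < ms_dim s)%N /\
    forall k, (k < size r)%N -> forall i0, carried s (u (nth i0 r k)).
Proof.
move=> uP; elim: r => [|i r [s1 [s1_gt0 s1P]]].
  (* Starting from a trivial one-dimensional system keeps the dimension positive even for an empty
     family. *)
  by exists (@MonSys F 1 (fun=> 1) id (fun=> 1) (fun=> oner_neq0 F)
    (fun=> oner_neq0 F)).
have [s2 s2P] := orbseq_carried (uP i).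
have [s [sdim sP]] := monsys_pair s1 s2.
exists s; split; first by rewrite sdim ltn_addr.
case=> [_ i0|k kr i0]; apply: sP; first by right.
by left; apply: s1P.
Qed.

(** * Definable sets and their closure properties *)

Definition definable (F : fieldType) (S : nat -> Prop) :=
  exists (I : finType) (u : I -> nat -> F),
    (forall i, orbseq (u i)) /\ forall n, S n <-> forall i, u i n = 0.

Lemma definable_ext (F : fieldType) (S S' : nat -> Prop) :
  (forall n, S n <-> S' n) -> definable F S -> definable F S'.
Proof.
move=> SS' [I [u [uP Su]]]; exists I, u; split=> // n.
exact: iff_trans (iff_sym (SS' n)) (Su n).
Qed.

Lemma definable_and (F : fieldType) (S S' : nat -> Prop) :
  definable F S -> definable F S' -> definable F (fun n => S n /\ S' n).
Proof.
move=> [I [u [uP Su]]] [I' [u' [uP' Su']]].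
exists (I + I')%type, (fun i => match i with inl a => u a | inr b => u' b end).
split=> [[a|b] //|n]; split=> [[/Su uS /Su' uS'] [a|b] //|uS].
by split; [apply/Su => a; apply: (uS (inl a))|apply/Su' => b; apply: (uS (inr b))].
Qed.

(** In a field, the pairwise products u_i u'_j all vanish exactly when one of the two families
    vanishes. *)
Lemma definable_or (F : fieldType) (S S' : nat -> Prop) :
  definable F S -> definable F S' -> definable F (fun n => S n \/ S' n).
Proof.
move=> [I [u [uP Su]]] [I' [u' [uP' Su']]].
exists (I * I')%type, (fun ij n => u ij.1 n * u' ij.2 n).
split=> [[a b]|n]; first exact: orbseq_mul.
split=> [[/Su uS|/Su' uS] [a b] /=|uS]; rewrite ?uS ?mul0r ?mulr0 //.
have [/forallP uS0|] := boolP [forall i, u i n == 0].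
  by left; apply/Su => i; apply/eqP.
rewrite negb_forall => /existsP [i ui]; right; apply/Su' => j.
by have /eqP := uS (i, j); rewrite mulf_eq0 (negPf ui) => /eqP.
Qed.

Lemma definable_exists (F : fieldType) (J : finType) (S : J -> nat -> Prop) :
  (forall j, definable F (S j)) -> definable F (fun n => exists j, S j n).
Proof.
move=> SP; suff: definable F (fun n => exists2 j, j \in enum J & S j n).
  apply: definable_ext => n.
  by split=> [[j _ Sj]|[j Sj]]; exists j; rewrite ?mem_enum.
elim: (enum J) => [|j r IHr].
  exists unit, (fun _ _ => 1); split=> [_|n]; first exact: orbseq_const.
  by split=> [[]//|/(_ tt)/eqP]; rewrite oner_eq0.
apply: definable_ext (definable_or (SP j) IHr) => n; split.
  by case=> [Sj|[i ir Si]]; [exists j; rewrite ?mem_head|exists i; rewrite // inE ir orbT].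
by case=> i; rewrite inE => /predU1P[->|ir] Si; [left|right; exists i].
Qed.

Lemma definable_const (F : fieldType) (b : bool) : definable F (fun=> b).
Proof.
exists unit, (fun _ _ => (~~ b)%:R); split=> [_|n]; first exact: orbseq_const.
by case: b; split=> // /(_ tt)/eqP; rewrite oner_eq0.
Qed.

(** Time is followed on a path of n0 nodes leading into a cycle of T nodes. Torus coordinates cannot
    be 0, so nodes are labelled 1 or [t], and the equation is label = 1. *)
Lemma definable_eventually_periodic (F : fieldType) (t : F) (b : pred nat) n0 T :
  t != 0 -> t != 1 -> (0 < T)%N ->
  (forall n, (n0 <= n)%N -> b (n + T)%N = b n) -> definable F b.
Proof.
move=> t0 t1 T_gt0 bT; set k := (n0 + T)%N.
have k_gt0 : (0 < k)%N by rewrite addn_gt0 T_gt0 orbT.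
have node_lt (i : 'I_k) : ((if i.+1 < k then i.+1 else n0) < k)%N.
  by case: (ltnP i.+1 k) => // _; rewrite -[X in (X < _)%N]addn0 ltn_add2l.
pose g (i : 'I_k) := Ordinal (node_lt i).
pose al (i : 'I_k) := if b i then 1 else t.
have al0 i : al i != 0 by rewrite /al; case: ifP; rewrite ?oner_neq0.
pose i0 := Ordinal k_gt0.
exists unit, (fun _ n => al (iter n g i0) + -1); split=> [_|n].
  by apply: orbseq_add; [apply: orbseq_iter|apply: orbseq_const].
have bn : b (iter n g i0) = b n.
  have: exists q, n = (iter n g i0 + q * T)%N /\
      ((0 < q)%N -> (n0 <= iter n g i0)%N).
    elim: n => [|n [q [nE qP]]]; first by exists 0%N.
    rewrite iterS /=; case: ltnP => [_|le_k].
      by exists q; split=> [|/qP]; [rewrite addSn -nE|apply: leqW].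
    have nk : (iter n g i0).+1 = k by apply/anti_leq; rewrite le_k ltn_ord.
    by exists q.+1; split=> //; rewrite mulSn addnA -/k -nk addSn -nE.
  case=> -[|q] [nE qP]; first by rewrite [in RHS]nE mul0n addn0.
  rewrite [in RHS]nE; elim: q.+1 => [|q' IHq]; first by rewrite mul0n addn0.
  by rewrite mulSn [(T + _)%N]addnC addnA bT // (leq_trans (qP isT)) ?leq_addr.
have -> : (forall _ : unit, al (iter n g i0) - 1 = 0) <-> al (iter n g i0) = 1.
  by split=> [/(_ tt)/eqP|-> _]; rewrite ?subrr // subr_eq0 => /eqP.
rewrite /al bn; case: (b n); split=> //.
by move/eqP; rewrite (negPf t1).
Qed.

Lemma definable_in_AP (F : fieldType) (t : F) (a b : nat) :
  t != 0 -> t != 1 -> definable F (in_AP a b).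
Proof.
move=> t0 t1; pose B n := ((a <= n) && (b %| n - a))%N.
have BP n : B n <-> in_AP a b n.
  split=> [/andP[an /dvdnP[q nq]]|[q ->]].
    by exists q; rewrite mulnC -nq subnKC.
  by rewrite /B leq_addr addKn dvdn_mulr.
apply: definable_ext BP _.
(* For b = 0 the progression is {a}; membership is constantly false beyond a, and the period is
   taken to be 1. *)
apply: (@definable_eventually_periodic _ t _ a.+1 (b + (b == 0))) => //.
  by case: (b).
move=> n an; rewrite /B (leq_trans (ltnW an)) ?leq_addr // (ltnW an) /=.
case: eqP => [->|_]; last by rewrite addn0 -addnBAC 1?ltnW // dvdn_addl.
by rewrite add0n !dvd0n !subn_eq0 [RHS]leqNgt an [LHS]leqNgt ltn_addr.
Qed.

Lemma definable_subvariety (F : fieldType) (S : nat -> Prop) :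
  definable F S ->
  exists (k : nat) (Phi : torus_endo F k) (alpha : 'I_k -> F) (V : seq {mpoly F[k]}),
    (0 < k)%N /\ torus_point alpha /\
    forall n : nat, in_subvariety V (iter n (endo_apply Phi) alpha) <-> S n.
Proof.
case=> I [u [uP Su]].
have [s [s_gt0 sP]] := orbseq_family_carried (enum I) uP.
have /fin_all_exists [P PE] i : carried s (u i).
  have := sP (index i (enum I)); rewrite index_mem mem_enum => /(_ isT i).
  by rewrite nth_index ?mem_enum.
pose co (i : 'I_(ms_dim s)) : laurent F (ms_dim s) :=
  (ms_coef i *: 'X_(ms_node i), 0%N).
have coU i : laurent_unit (co i).
  (* The inverse of a coordinate is the product of the others divided by x_1...x_k. *)
  exists ((ms_coef i)^-1 *: \prod_(j | j != ms_node i) 'X_j, 1%N).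
  rewrite /= /xprod expr1 [RHS](bigD1 (ms_node i)) //=.
  by rewrite -scalerAl -scalerAr scalerA divff ?ms_coef_neq0 // scale1r.
pose Phi := TorusEndo coU.
have orbE n i : iter n (endo_apply Phi) (@ms_start F s) i = ms_orbit s n i.
  elim: n i => [|n IHn] i //.
  by rewrite ms_orbitS iterS /endo_apply /laurent_eval /= divr1 mevalZ mevalXU IHn.
exists (ms_dim s), Phi, (@ms_start F s), [seq P i | i <- enum I].
split=> //; split=> [i|n]; first exact: ms_start_neq0.
apply: iff_trans (iff_sym (Su n)); split=> [[_ VP] i|uS].
  rewrite PE -(meval_eq _ (orbE n)); apply: VP.
  by rewrite map_f // mem_enum.
split=> [i|f /mapP[i _ ->]]; first by rewrite orbE ms_orbit_neq0.
by rewrite (meval_eq _ (orbE n)) -PE uS.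
Qed.

(** * Closedness up to permutation of the roots *)

(** The weights are the coefficients of the Lagrange basis polynomials. They turn each coefficient
    of an interpolating polynomial into a fixed linear form in its values, which will be geometric
    sequences in n. *)
Lemma lagrange_weights (F : fieldType) (rs : seq F) : uniq rs ->
  exists w : nat -> F -> F, forall p : {poly F}, (size p <= size rs)%N ->
    forall l, p`_l = \sum_(x <- rs) w l x * p.[x].
Proof.
move=> rsU; pose N x := \prod_(y <- rem x rs) ('X - y%:P).
pose L x := (N x).[x]^-1 *: N x.
have N0 x : x \in rs -> (N x).[x] != 0.
  move=> xrs; rewrite horner_prod prodf_seq_neq0; apply/allP => y.
  rewrite mem_rem_uniq // inE => /andP[yx _].
  by rewrite hornerXsubC subr_eq0 eq_sym.
have Lx x y : x \in rs -> y \in rs -> (L x).[y] = (x == y)%:R.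
  move=> xrs yrs; rewrite hornerZ; case: (eqVneq x y) => [<-|xy].
    by rewrite mulVf ?N0.
  apply/eqP; rewrite mulf_eq0; apply/orP; right.
  rewrite horner_prod prodf_seq_eq0; apply/hasP; exists y => /=.
    by rewrite mem_rem_uniq // inE eq_sym xy.
  by rewrite hornerXsubC subrr.
exists (fun l x => (L x)`_l) => p sp l.
suff -> : p = \sum_(x <- rs) p.[x] *: L x.
  rewrite coef_sum; apply: eq_big_seq => x xrs; rewrite coefZ mulrC.
  rewrite horner_sum (bigD1_seq x) //= hornerZ Lx // eqxx mulr1 big1_seq ?addr0 //.
  by move=> y /andP[yx yrs]; rewrite hornerZ Lx // (negPf yx) mulr0.
apply/eqP; rewrite -subr_eq0; set q := p - _.
have [//|q0] := eqVneq q 0; have := max_poly_roots q0 _ rsU.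
have -> : all (root q) rs.
  apply/allP => x xrs; rewrite /root hornerD hornerN horner_sum.
  rewrite (bigD1_seq x) //= hornerZ Lx // eqxx mulr1 big1_seq ?addr0 ?subrr //.
  by move=> y /andP[yx yrs]; rewrite hornerZ Lx // (negPf yx) mulr0.
move=> /(_ isT); rewrite ltnNge => /negP[]; rewrite /q.
apply: leq_trans (size_polyD _ _) _; rewrite geq_max sp size_polyN.
rewrite big_seq; apply: leq_trans (size_sum _ _ _) _; apply/bigmax_leqP_seq => x xrs _.
apply: leq_trans (size_scale_leq _ _) _; apply: leq_trans (size_scale_leq _ _) _.
by rewrite /N size_prod_XsubC size_rem //; case: (rs) xrs.
Qed.

Lemma meval_msym n (R : comNzRingType) (s : 'S_n) (v : 'I_n -> R) (P : {mpoly R[n]}) :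
  (msym s P).@[v] = P.@[v \o s].
Proof.
have -> : msym s P = P \mPo [tuple 'X_(s i) | i < n].
  rewrite /comp_mpoly /msym /mmap; apply: eq_bigr => m _; congr (_ * _).
  by apply: mmap1_eq => i; rewrite tnth_mktuple.
rewrite comp_mpoly_meval; apply: meval_eq => i.
by rewrite tnth_mktuple mevalXU.
Qed.

(* Being a zero of the [P i] after some permutation of the coordinates is the
   vanishing of the product, over all permutations, of the polynomials
   [\sum_i P i T^i] in an auxiliary variable [T]; its coefficients are symmetric. *)
Lemma exists_perm_closed (F : fieldType) n r (P : 'I_r -> {mpoly F[n]}) :
  exists k (H : 'I_k -> {mpoly F[n]}), forall y : 'I_n -> F,
    (forall i, (H i).@[fun j : 'I_n => (-1) ^+ j.+1 *
                   (\prod_(l < n) ('X - (y l)%:P))`_(n - j.+1)] = 0) <->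
    exists s : 'S_n, forall i, (P i).@[y \o s] = 0.
Proof.
pose R (s : 'S_n) : {poly {mpoly F[n]}} := \sum_(i < r) (msym s (P i))%:P * 'X^i.
pose G := \prod_s R s.
have Gsym k : G`_k \is symmetric.
  (* Applying [msym s] only permutes the factors of [G]. *)
  apply/issymP => s; have mG : map_poly (msym s) G = G.
    rewrite rmorph_prod [RHS](reindex_inj (@mulIg _ s)) /=.
    apply: eq_bigr => s' _; rewrite rmorph_sum; apply: eq_bigr => i _.
    by rewrite rmorphM /= map_polyC /= map_polyXn msymMm.
  by rewrite -[in LHS]coef_map mG.
pose H (i : 'I_(size G)) := sval (sym_fundamental (Gsym i)).
exists (size G), H => y.
(* With the sign, the coefficient of index n - (j + 1) is the elementary symmetric polynomial of
   degree j + 1 in the roots. *)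
have HE i : (H i).@[fun j : 'I_n => (-1) ^+ j.+1 *
    (\prod_(l < n) ('X - (y l)%:P))`_(n - j.+1)] = (G`_i).@[y].
  rewrite /H; case: (sym_fundamental _) => h [/= hE _]; rewrite -hE comp_mpoly_meval.
  apply: meval_eq => j; rewrite tnth_mktuple.
    have -> : \prod_(l < n) ('X - (y l)%:P) = \prod_(c <- [tuple y l | l < n]) ('X - c%:P).
    by rewrite big_tuple; apply: eq_bigr => l _; rewrite tnth_mktuple.
  have jn : (j.+1 < n.+1)%N by rewrite ltnS ltn_ord.
  rewrite (mroots_coeff _ (Ordinal jn)) /= mulrA -exprD addnn -signr_odd odd_double.
  rewrite expr0 mul1r.
  by apply: meval_eq => l; rewrite tnth_mktuple.
have GE : map_poly (meval y) G = \prod_(s : 'S_n) \sum_(i < r) ((P i).@[y \o s])%:P * 'X^i.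
  rewrite rmorph_prod; apply: eq_bigr => s _.
  rewrite rmorph_sum; apply: eq_bigr => i _.
  by rewrite rmorphM /= map_polyC /= map_polyXn meval_msym.
have -> : (forall i, (H i).@[fun j : 'I_n => (-1) ^+ j.+1 *
    (\prod_(l < n) ('X - (y l)%:P))`_(n - j.+1)] = 0) <-> map_poly (meval y) G = 0.
  split=> [H0|G0 i]; last by rewrite HE -coef_map G0 coef0.
  apply/polyP => k; rewrite coef0 coef_map.
  have [kG|Gk] := ltnP k (size G); first by rewrite -[RHS](H0 (Ordinal kG)) HE.
  by rewrite nth_default // /= meval0.
have sumE (s : 'S_n) : (\sum_(i < r) ((P i).@[y \o s])%:P * 'X^i == 0 :> {poly F}) <->
    forall i, (P i).@[y \o s] = 0.
  split=> [/eqP S0 i|P0]; last by rewrite big1 // => i _; rewrite P0 mul0r.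
  have := congr1 (fun q : {poly F} => q`_i) S0.
  rewrite coef0 coef_sum (bigD1 i) //= coefCM coefXn eqxx mulr1 big1 ?addr0 //.
  by move=> j ji; rewrite coefCM coefXn eq_sym (inj_eq val_inj) (negPf ji) mulr0.
rewrite GE; split=> [/eqP/prodf_eq0[s _ /sumE sP]|[s /sumE sP]]; first by exists s.
by apply/eqP/prodf_eq0; exists s.
Qed.

(** * Finite fields and binomials modulo p *)

Lemma pchar_nat_expn (R : nzSemiRingType) p n :
  p \in [pchar R] -> [pchar R].-nat (p ^ n)%N.
Proof.
by move=> pR; rewrite (eq_pnat _ (pcharf_eq pR)) pnatX pnat_id ?(pcharf_prime pR).
Qed.

Lemma exprB_pchar_pow (R : comNzRingType) p n (x y : R) :
  p \in [pchar R] -> (x - y) ^+ (p ^ n) = x ^+ (p ^ n) - y ^+ (p ^ n).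
Proof.
move=> pR; rewrite -[in RHS](subrK y x) [in RHS]exprDn_pchar ?addrK //.
exact: pchar_nat_expn.
Qed.

(** X^q - X has derivative -1 in characteristic p, so its roots are distinct. *)
Lemma uniq_roots_Xq_sub_X (F : closedFieldType) p K :
  p \in [pchar F] -> (0 < K)%N ->
  exists2 rs : seq F, uniq rs /\ size rs = (p ^ K)%N & forall x, x \in rs -> x ^+ (p ^ K) = x.
Proof.
move=> pF K_gt0; have p_pr := pcharf_prime pF.
have Q_gt1 : (1 < p ^ K)%N by rewrite -(exp1n K) ltn_exp2r // prime_gt1.
set q : {poly F} := 'X^(p ^ K) - 'X.
have sX : (size (- 'X : {poly F}) < size ('X^(p ^ K) : {poly F}))%N.
  by rewrite size_polyN size_polyX size_polyXn ltnS.
have [rs qE] := closed_field_poly_normal q.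
have qm : lead_coef q = 1 by rewrite /q lead_coefDl // lead_coefXn.
rewrite qm scale1r in qE.
exists rs; [split|].
- rewrite -separable_prod_XsubC -qE unlock /q derivB derivXn derivX.
  rewrite -mulr_natr -polyCMn natrX (pcharf0 pF) expr0n eqn0Ngt K_gt0 mulr0n.
  by rewrite polyC0 mulr0 sub0r -[- 1]scaleN1r coprimepZr ?coprimep1 // oppr_eq0 oner_neq0.
- have: size q = (p ^ K).+1 by rewrite /q size_polyDl // size_polyXn.
  by rewrite qE size_prod_XsubC => -[].
move=> x xrs; have: root q x by rewrite qE root_prod_XsubC.
by rewrite /root !hornerE subr_eq0 => /eqP.
Qed.

Lemma coef_1DX_expn (R : comNzRingType) n k : ((1 + 'X) ^+ n : {poly R})`_k = 'C(n, k)%:R.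
Proof.
rewrite exprDn coef_sum.
have [kn|nk] := ltnP k n.+1.
  rewrite (bigD1 (Ordinal kn)) //= coefMn expr1n mul1r coefXn eqxx.
  rewrite big1 ?addr0 // => i ik; rewrite coefMn expr1n mul1r coefXn.
  by rewrite eq_sym -[k]/(val (Ordinal kn)) (inj_eq val_inj) (negPf ik) mul0rn.
rewrite bin_small // big1 // => i _; rewrite coefMn expr1n mul1r coefXn.
by rewrite gtn_eqF ?mul0rn // (leq_trans (ltn_ord i)).
Qed.

(* One step of Lucas' congruence. *)
Lemma natr_bin_Lucas (F : fieldType) p d i M l :
  p \in [pchar F] -> (i <= d)%N -> (d < p)%N ->
  'C(d + p * M, i + p * l)%:R = 'C(d, i)%:R * 'C(M, l)%:R :> F.
Proof.
move=> pF id dp; have p_gt0 : (0 < p)%N by apply: leq_trans dp.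
(* Frobenius gives (1 + X)^(pM) = (1 + X^p)^M, where only exponents divisible by p occur. *)
have E1 : (1 + 'X : {poly F}) ^+ (p * M) = (1 + 'X) ^+ M \Po 'X^p.
  have pX : p \in [pchar {poly F}] by rewrite (pchar_lalg _).
  rewrite exprM exprDn_pchar; last by rewrite -[p]expn1 pchar_nat_expn.
  rewrite expr1n [RHS]rmorphXn /=.
  by rewrite comp_polyD comp_polyX comp_polyC.
rewrite -!coef_1DX_expn exprD E1 coefM.
have iS : (i < (i + p * l).+1)%N by rewrite ltnS leq_addr.
rewrite (bigD1 (Ordinal iS)) //= coef_comp_poly_Xn // addKn dvdn_mulr // mulKn //.
rewrite big1 ?addr0 // => j ji; rewrite coef_comp_poly_Xn // !coef_1DX_expn.
case: ifP => [pj|_]; last by rewrite mulr0.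
have [jd|dj] := leqP j d; last by rewrite bin_small ?mul0r.
case/eqP: ji; apply/val_inj => /=.
have jil : (j <= i + p * l)%N by rewrite -ltnS.
have /eqP jE : (i + p * l == j %[mod p])%N by rewrite eqn_mod_dvd.
have iE : ((i + p * l) %% p = i)%N.
  by rewrite addnC mulnC modnMDl modn_small // (leq_ltn_trans id).
by rewrite -[LHS](modn_small (leq_ltn_trans jd dp)) -jE iE.
Qed.

(** [a] lists the powers of p in the base-p expansion of M, lowest first, each repeated as often as
    its digit says. The digits of a partial sum are at most those of M, so by Lucas the binomial is
    a product of some 'C(d, i) with i <= d < p, none divisible by p. *)
Lemma pdigits_bin_neq0 (F : fieldType) p M : p \in [pchar F] ->
  exists a : seq nat, M = (\sum_(i <- a) p ^ i)%N /\
    forall k, 'C(M, \sum_(i <- take k a) p ^ i)%:R != 0 :> F.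
Proof.
move=> pF; have p_pr := pcharf_prime pF; have p_gt1 := prime_gt1 p_pr.
elim/ltn_ind: M => M IHM; have [->|M_gt0] := posnP M.
  by exists [::]; rewrite big_nil; split=> // k; rewrite bin0 oner_neq0.
have [a [aE aP]] := IHM (M %/ p)%N (ltn_Pdiv p_gt1 M_gt0).
set d := (M %% p)%N; have dp : (d < p)%N by rewrite ltn_mod prime_gt0.
have ME : M = (d + p * (M %/ p))%N by rewrite addnC mulnC -divn_eq.
have sumS (s : seq nat) : (\sum_(i <- [seq i.+1 | i <- s]) p ^ i = p * \sum_(i <- s) p ^ i)%N.
  by rewrite big_map big_distrr; apply: eq_bigr => i _; rewrite /= expnS.
have sum0 k : (\sum_(i <- nseq k 0) p ^ i = k)%N.
  by rewrite big_nseq iter_addn_0 expn0 mul1n.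
have bin_d i : (i <= d)%N -> 'C(d, i)%:R != 0 :> F.
  move=> id; rewrite -(dvdn_pcharf pF); apply/negP => pC.
  have: (p %| d`!)%N by rewrite -(bin_fact id) dvdn_mulr.
  apply/negP; elim: (d) dp => [|n IHn] np; first by rewrite fact0 dvdn1 gtn_eqF.
  by rewrite factS Euclid_dvdM // negb_or gtnNdvd // IHn // ltnW.
exists (nseq d 0 ++ [seq i.+1 | i <- a]); split=> [|k].
  by rewrite big_cat /= sum0 sumS -aE.
rewrite take_cat size_nseq -map_take; case: ltnP => [kd|dk].
  rewrite take_nseq 1?ltnW // sum0 {1}ME -[k]addn0 -[in (k + 0)%N](muln0 p).
  by rewrite natr_bin_Lucas ?(ltnW kd) // bin0 mulr1 bin_d // ltnW.
by rewrite big_cat /= sum0 sumS {1}ME natr_bin_Lucas // mulf_neq0 ?bin_d.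
Qed.

(** * Interpolation on F_q *)

(* The exponent in [0, q-1] such that [x ^+ b = x ^+ red_exp q b] on F_q; it is
   0 only for [b = 0]. *)
Definition red_exp (q b : nat) : nat := if b is b'.+1 then (b' %% q.-1).+1 else 0.

Lemma expr_red_exp (R : pzSemiRingType) q (x : R) b :
  (1 < q)%N -> x ^+ q = x -> x ^+ b = x ^+ red_exp q b.
Proof.
case: b => [//|b] q_gt1 xq; rewrite /red_exp [in LHS](divn_eq b q.-1).
elim: (b %/ q.-1)%N => [|k IHk]; first by rewrite mul0n.
rewrite mulSn -[LHS]/(x ^+ (q.-1 + k * q.-1 + b %% q.-1).+1) -IHk.
rewrite -[in RHS]addn1 -addnA -addSn prednK; last exact: ltnW.
rewrite exprD xq -exprS; congr (_ ^+ _).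
by rewrite addn1.
Qed.

Lemma ltn_red_exp q b : (1 < q)%N -> (red_exp q b < q)%N.
Proof.
case: q b => [|[|q]] [|b] //= _; by rewrite !ltnS -ltnS ltn_mod.
Qed.

Lemma red_exp_mod q b w : (0 < w)%N -> (w < q)%N -> (w <= b)%N ->
  b = w %[mod q.-1] -> red_exp q b = w.
Proof.
case: q b w => [|q] [|b] [|w] //= _; rewrite !ltnS => wq wb bw.
have : (b + 1 == w + 1 %[mod q])%N by rewrite !addn1 bw.
by rewrite eqn_modDr [(w %% _)%N]modn_small // => /eqP->.
Qed.

Lemma modn_expn_pred q n : (0 < q)%N -> q ^ n = 1 %[mod q.-1].
Proof.
move=> q_gt0; apply/eqP; rewrite eqn_mod_dvd ?expn_gt0 ?q_gt0 //.
by rewrite subn1 dvdn_pred_predX.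
Qed.

(** Transcendence over the prime field, whose elements in characteristic p are the images of
    integers. *)
Definition transc (F : fieldType) (t : F) := forall n (c : nat -> int),
  \sum_(b < n) (c b)%:~R * t ^+ b = 0 -> forall b, (b < n)%N -> (c b)%:~R = 0 :> F.

Section Interpolation.

Context (F : fieldType) (p K : nat) (t : F) (rs : seq F) (w : nat -> F -> F).
Local Notation q := (p ^ K)%N.
Hypotheses (pF : p \in [pchar F]) (K_gt0 : (0 < K)%N) (t_tr : transc t).
Hypothesis rs_fix : forall x, x \in rs -> x ^+ q = x.
Hypothesis wP : forall f : {poly F}, (size f <= q)%N ->
  forall l, f`_l = \sum_(x <- rs) w l x * f.[x].

Let p_gt1 : (1 < p)%N. Proof. exact/prime_gt1/(pcharf_prime pF). Qed.
Let q_gt1 : (1 < q)%N. Proof. by rewrite -(exp1n K) ltn_exp2r. Qed.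

(** The coefficient of X^l in the polynomial of degree less than q that interpolates x |-> (x - t)^M
    on F_q. *)
Definition icoef l M := \sum_(x <- rs) w l x * (x - t) ^+ M.

(** For x in F_q, (x - t)^(q^i) = x - t^(q^i). The product has degree less than q, so it is the
    interpolating polynomial itself. *)
Lemma icoef_prod (s : seq nat) l : (size s < q)%N ->
  icoef l (\sum_(i <- s) q ^ i)%N = (\prod_(i <- s) ('X - (t ^+ (q ^ i))%:P))`_l.
Proof.
move=> sq; rewrite wP; last first.
  by rewrite -(big_map (fun i => t ^+ (q ^ i)) xpredT (fun y => 'X - y%:P)) size_prod_XsubC size_map.
apply: eq_big_seq => x xrs; rewrite horner_prod; congr (_ * _).
rewrite expr_sum; apply: eq_bigr => i _.
rewrite hornerXsubC -expnM exprB_pchar_pow // expnM; congr (_ - _).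
by elim: i => [|i IHi]; rewrite ?expr1 // expnSr exprM IHi rs_fix.
Qed.

(* No cancellation: the terms of [icoef l M] are distinct powers of [t]. *)
Lemma icoef_eq0_bin l M b : icoef l M = 0 -> (b <= M)%N -> red_exp q b = l ->
  'C(M, b)%:R = 0 :> F.
Proof.
move=> l0 bM bl.
(* The coefficient of t^i in [icoef l M], once x^(M - i) is reduced to an exponent below q. *)
pose c i : int := (-1) ^+ i * ('C(M, i) * (red_exp q (M - i) == l))%:R.
have sumc : \sum_(i < M.+1) (c i)%:~R * t ^+ i = 0.
  have wE x : x \in rs -> w l x * (x - t) ^+ M = \sum_(i < M.+1)
      w l x * ((-1) ^+ i * x ^+ red_exp q (M - i) * t ^+ i *+ 'C(M, i)).
    move=> xrs; rewrite exprBn mulr_sumr; apply: eq_bigr => i _.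
    by rewrite -(expr_red_exp _ q_gt1 (rs_fix xrs)).
  rewrite -[RHS]l0 /icoef (eq_big_seq _ wE).
  rewrite exchange_big /=; apply: eq_bigr => i _.
  have := wP (f := 'X^(red_exp q (M - i))) _ l.
  rewrite size_polyXn coefXn => /(_ (ltn_red_exp _ q_gt1)) lE.
  rewrite /c rmorphM rmorphXn rmorphN1 /= natrM rmorphM /= [_ == l]eq_sym.
  rewrite !rmorph_nat lE mulr_sumr mulr_sumr mulr_suml; apply: eq_bigr => x _.
  rewrite hornerXn -mulr_natr; ring.
have := t_tr sumc (b := (M - b)%N); rewrite ltnS leq_subr => /(_ isT).
rewrite /c subKn // bl eqxx muln1 bin_sub // rmorphM rmorphXn rmorphN1 rmorph_nat /=.
by move/eqP; rewrite mulf_eq0 signr_eq0 => /eqP.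
Qed.

(* Add the [p]-powers composing [M] one at a time: each contributes at most
   [q / p] to the exponent modulo [q - 1], so the partial sums cannot jump over
   the gap between [E] and [q]. *)
Lemma icoef_eq0_sum_powers E M : (E * p < q)%N ->
  (forall l, (E < l < q)%N -> icoef l M = 0) ->
  exists s : seq nat, (size s <= E)%N /\ M = (\sum_(i <- s) q ^ i)%N.
Proof.
move=> Eq l0; have [a [aE aP]] := pdigits_bin_neq0 M pF.
(* Since q = 1 modulo q - 1, lowering each exponent of p modulo K preserves the residue of the
   sum. *)
pose W s := (\sum_(i <- s) p ^ (i %% K))%N.
have pE i : (p ^ i = p ^ (i %% K) * q ^ (i %/ K))%N.
  by rewrite -expnM -expnD mulnC addnC -divn_eq.
have WE s : W s = \sum_(i <- s) p ^ i %[mod q.-1].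
  rewrite /W; elim: s => [|i s IHs]; first by rewrite !big_nil.
  rewrite !big_cons -modnDm IHs modnDm -modnDml [in RHS]pE -[in RHS]modnDml.
  by rewrite -[in RHS]modnMmr modn_expn_pred ?(ltnW q_gt1) // modnMmr muln1.
have W_le s : (W s <= \sum_(i <- s) p ^ i)%N.
  by apply: leq_sum => i _; rewrite leq_exp2l // leq_mod.
have WE_le k : (W (take k a) <= E)%N.
  elim: k => [|k IHk]; first by rewrite take0 /W big_nil.
  have [ak|ka] := leqP (size a) k.
    by rewrite take_oversize ?(leq_trans ak) // -(take_oversize ak).
  have Wk : W (take k.+1 a) = (W (take k a) + p ^ (nth 0 a k %% K))%N.
    by rewrite (take_nth 0 ka) /W -cats1 big_cat big_seq1.
  (* A bound E < q / p plus a step of at most q / p stays below 2q / p <= q. *)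
  have Wq : (W (take k.+1 a) < q)%N.
    rewrite Wk -(ltn_pmul2r (ltnW p_gt1)) mulnDl -expnSr.
    have : (p ^ (nth 0 a k %% K).+1 <= q)%N by rewrite leq_exp2l // ltn_mod.
    have : (W (take k a) * p <= E * p)%N by rewrite leq_mul2r IHk orbT.
    have : (q * 2 <= q * p)%N by rewrite leq_mul2l p_gt1 orbT.
    by move: Eq; lia.
  have W_gt0 : (0 < W (take k.+1 a))%N by rewrite Wk ltn_addl // expn_gt0 ltnW.
  (* A value in the gap would be the reduced exponent of the partial sum, making a nonzero binomial
     vanish. *)
  rewrite leqNgt; apply: contra (aP k.+1) => EW; apply/eqP.
  apply: (icoef_eq0_bin (l0 (W (take k.+1 a)) _)); first by rewrite EW Wq.
    by rewrite [X in (_ <= X)%N]aE -{2}(cat_take_drop k.+1 a) big_cat leq_addr.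
  by apply: red_exp_mod => //; rewrite -WE.
(* Each p^i is p^(i mod K) copies of q^(i / K); the number of copies in all is [W a]. *)
exists (flatten [seq nseq (p ^ (i %% K)) (i %/ K)%N | i <- a]); split.
  have := WE_le (size a); rewrite take_size /W; congr (_ <= _)%N.
  by rewrite size_flatten /shape -map_comp sumnE big_map; apply: eq_bigr => i _; rewrite /= size_nseq.
rewrite aE big_flatten big_map; apply: eq_bigr => i _.
by rewrite big_nseq iter_addn_0 mulnC -pE.
Qed.

End Interpolation.

(** * Transcendence of t and sums of powers of q with multiplicities *)

Lemma transc_tofracX (k : fieldType) : transc (tofrac 'X : {fraction {poly k}}).
Proof.
move=> n c; pose f : {poly k} := \sum_(b < n) (c b)%:~R * 'X^b.
have -> : \sum_(b < n) (c b)%:~R * (tofrac 'X : {fraction {poly k}}) ^+ b = tofrac f.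
  rewrite rmorph_sum; apply: eq_bigr => b _.
  by rewrite rmorphM rmorphXn rmorph_int.
move/eqP; rewrite tofrac_eq0 => /eqP f0 b bn.
have : f`_b = (c b)%:~R.
  rewrite coef_sum (bigD1 (Ordinal bn)) //= mulrzl coefMrz coefXn eqxx big1 ?addr0 // => i ib.
  rewrite mulrzl coefMrz coefXn eq_sym -[b]/(val (Ordinal bn)) (inj_eq val_inj).
  by rewrite (negPf ib) mul0rz.
rewrite f0 coef0 => cb0; apply/eqP.
have -> : (c b)%:~R = tofrac ((c b)%:~R : {poly k}) by rewrite rmorph_int.
by rewrite tofrac_eq0 -[_%:~R](rmorph_int polyC) -cb0 rmorph0.
Qed.

Lemma transc_expr_inj (F : fieldType) (t : F) : transc t -> injective (fun a => t ^+ a).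
Proof.
move=> t_tr a b /= ab; apply/eqP; apply/idPn => anb.
pose c i : int := (i == a)%:R - (i == b)%:R.
have sumd d n : (d < n)%N -> \sum_(i < n) (i == d :> nat)%:R * t ^+ i = t ^+ d.
  move=> dn; rewrite (bigD1 (Ordinal dn)) //= eqxx mul1r big1 ?addr0 // => i id.
  by rewrite -[d]/(val (Ordinal dn)) (inj_eq val_inj) (negPf id) mul0r.
have sumc : \sum_(i < (a + b).+1) (c i)%:~R * t ^+ i = 0.
  under eq_bigr => i _ do rewrite rmorphB /= !rmorph_nat mulrBl.
  by rewrite sumrB !sumd ?ab ?subrr // ltnS ?leq_addr ?leq_addl.
have := t_tr _ _ sumc a; rewrite ltnS leq_addr => /(_ isT)/eqP.
by rewrite /c eqxx (negPf anb) subr0 rmorph1 oner_eq0.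
Qed.

Lemma exists_blocks m (e : 'I_m -> nat) :
  exists bl : 'I_(\sum_j e j) -> 'I_m, forall f : 'I_m -> nat,
    (\sum_i f (bl i) = \sum_j e j * f j)%N.
Proof.
pose s := flatten [seq nseq (e j) j | j <- enum 'I_m].
have ss : size s == (\sum_j e j)%N.
  rewrite size_flatten /shape -map_comp sumnE big_map big_enum /=.
  by apply/eqP/eq_bigr => j _; rewrite size_nseq.
exists (tnth (Tuple ss)) => f.
rewrite -(big_tuple _ _ (Tuple ss) xpredT f) /= big_flatten big_map big_enum /=.
by apply: eq_bigr => j _; rewrite big_nseq iter_addn_0 mulnC.
Qed.

(** The first condition makes M a sum of at most E powers of q, the second makes their number
    exactly E, and the third groups them into blocks of sizes e_j. *)
Lemma icoef_sum_powers (F : fieldType) p K (t : F) (rs : seq F) (w : nat -> F -> F)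
    m (e : 'I_m -> nat) (E := (\sum_j e j)%N) :
  p \in [pchar F] -> (0 < K)%N -> transc t ->
  (forall x, x \in rs -> x ^+ (p ^ K) = x) ->
  (forall f : {poly F}, (size f <= p ^ K)%N ->
     forall l, f`_l = \sum_(x <- rs) w l x * f.[x]) ->
  (E * p < p ^ K)%N ->
  exists k (H : 'I_k -> {mpoly F[E]}), forall M,
    (exists s : 'I_m -> nat, M = \sum_j e j * (p ^ K) ^ s j)%N <->
    [/\ forall l, (E < l < p ^ K)%N -> icoef t rs w l M = 0,
        icoef t rs w E M = 1 &
        forall i, (H i).@[fun j : 'I_E =>
                     (-1) ^+ j.+1 * icoef t rs w (E - j.+1) M] = 0].
Proof.
move=> pF K_gt0 t_tr rs_fix wP Eq.
have p_gt1 : (1 < p)%N by exact/prime_gt1/(pcharf_prime pF).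
have E_lt : (E < p ^ K)%N.
  by apply: leq_ltn_trans Eq; rewrite -{1}[E]muln1 leq_mul2l ltnW ?orbT.
have [bl blE] := exists_blocks e.
pose pk j := [pick i | bl i == j].
pose rep i := odflt i (pk (bl i)).
(* Roots are constant on blocks when each equals the root at the chosen representative of its
   block. *)
have [k [H HP]] := exists_perm_closed (fun i : 'I_E => 'X_i - 'X_(rep i) : {mpoly F[E]}).
exists k, H => M; split.
  case=> s Ms; pose y (i : 'I_E) := t ^+ ((p ^ K) ^ s (bl i)).
  have icE l : icoef t rs w l M = (\prod_(i < E) ('X - (y i)%:P))`_l.
    pose ss := [seq s (bl i) | i <- enum 'I_E].
    have -> : M = (\sum_(x <- ss) (p ^ K) ^ x)%N.
      by rewrite /ss big_map big_enum /= (blE (fun j => (p ^ K) ^ s j)%N).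
    have sq : (size ss < p ^ K)%N by rewrite size_map size_enum_ord.
    by rewrite (icoef_prod _ pF) // /ss big_map big_enum.
  have sizeP : size (\prod_(i < E) ('X - (y i)%:P)) = E.+1.
    by rewrite size_prod_XsubC /index_enum -enumT size_enum_ord.
  split=> [l /andP[El _]||].
  - by rewrite icE nth_default // sizeP.
  - rewrite icE; have /monicP := monic_prod_XsubC (index_enum 'I_E) xpredT y.
    by rewrite /lead_coef sizeP.
  move=> i; under meval_eq => j do rewrite icE.
  move: i; apply/HP; exists 1%g => i.
  rewrite mevalB !mevalXU /= !perm1 /y; suff -> : bl (rep i) = bl i by rewrite subrr.
  by rewrite /rep /pk; case: pickP => [i' /eqP|].
case=> ic0 ic1 HM; have [s [sE MsE]] := icoef_eq0_sum_powers pF K_gt0 t_tr rs_fix wP Eq ic0.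
have icE l : icoef t rs w l M = (\prod_(i <- s) ('X - (t ^+ ((p ^ K) ^ i))%:P))`_l.
  by rewrite MsE (icoef_prod _ pF) // (leq_ltn_trans sE).
(* With fewer than E factors the degree would be below E, and the coefficient at E would be 0
   instead of 1. *)
have {sE} sE : size s = E.
  apply/anti_leq; rewrite sE /= leqNgt; apply/negP => sE'.
  move/eqP: ic1; rewrite icE nth_default ?(eq_sym 0) ?oner_eq0 //.
  rewrite -(big_map (fun i => t ^+ ((p ^ K) ^ i)) xpredT (fun y => 'X - y%:P)).
  by rewrite size_prod_XsubC size_map.
pose y (i : 'I_E) := t ^+ ((p ^ K) ^ nth 0 s i).
have icE' l : icoef t rs w l M = (\prod_(i < E) ('X - (y i)%:P))`_l.
  by rewrite icE (big_nth 0) big_mkord sE.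
have /HP [sg sgP] : forall i, (H i).@[fun j : 'I_E => (-1) ^+ j.+1 *
    (\prod_(l < E) ('X - (y l)%:P))`_(E - j.+1)] = 0.
  by move=> i; rewrite -[RHS](HM i); apply: meval_eq => j; rewrite icE'.
have sg_rep i : nth 0 s (sg i) = nth 0 s (sg (rep i)).
  have /eqP := sgP i; rewrite mevalB !mevalXU /= subr_eq0 => /eqP.
  move/(transc_expr_inj t_tr)/eqP; rewrite eqn_exp2l; first by move/eqP.
  by rewrite -(exp1n K) ltn_exp2r.
(* The default 0 serves the empty blocks, where e_j = 0. *)
exists (fun j => if pk j is Some i then nth 0 s (sg i) else 0)%N.
rewrite -(blE (fun j => (p ^ K) ^ (if pk j is Some i then nth 0 s (sg i) else 0))%N).
rewrite {1}MsE (big_nth 0) big_mkord sE (reindex_inj (@perm_inj _ sg)) /=.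
apply: eq_bigr => i _; congr (_ ^ _)%N; rewrite sg_rep /rep.
by rewrite /pk; case: pickP => [//|/(_ i)]; rewrite eqxx.
Qed.

(** * p-sets *)

Lemma pchar_Fpbar p : prime p -> p \in [pchar Fpbar p].
Proof.
move=> p_pr; rewrite /Fpbar; case: countable_algebraic_closure => /= L [f _].
exact: (rmorph_pchar f) (pchar_Fp p_pr).
Qed.

Lemma pchar_Kfield p : prime p -> p \in [pchar Kfield p].
Proof.
move=> p_pr; have pX : p \in [pchar {poly Fpbar p}] by rewrite (pchar_lalg _) pchar_Fpbar.
rewrite inE /= p_pr -[_%:R](rmorph_nat (tofrac (R := {poly Fpbar p}))) /=.
by rewrite (pcharf0 pX) rmorph0.
Qed.

Definition Kvar p : Kfield p := tofrac 'X.

Lemma Kvar_neqC p (c : Fpbar p) : tofrac c%:P - Kvar p != 0.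
Proof.
rewrite -tofracB tofrac_eq0 subr_eq0; apply/eqP => /(congr1 (fun q : {poly _} => size q)).
by rewrite size_polyX size_polyC; case: (c != 0).
Qed.

Lemma Kvar_neq0 p : Kvar p != 0.
Proof. by rewrite tofrac_eq0 polyX_eq0. Qed.

Lemma Kvar_neq1 p : Kvar p != 1.
Proof. by have := Kvar_neqC (1 : Fpbar p); rewrite tofrac1 subr_eq0 eq_sym. Qed.

(** F_q is taken among the constants, so x - t never vanishes on it and negative powers make
    sense. *)
Lemma Kfield_fixed_roots p K : prime p -> (0 < K)%N ->
  exists rs : seq (Kfield p), [/\ uniq rs, size rs = (p ^ K)%N,
    forall x, x \in rs -> x ^+ (p ^ K) = x & forall x, x \in rs -> x - Kvar p != 0].
Proof.
move=> p_pr K_gt0.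
have [rs [rsU rsS] rsQ] := uniq_roots_Xq_sub_X (pchar_Fpbar p_pr) K_gt0.
exists [seq tofrac c%:P | c <- rs]; split.
- rewrite map_inj_uniq // => a b /eqP; rewrite tofrac_eq => /eqP.
  exact: polyC_inj.
- by rewrite size_map.
- by move=> _ /mapP[c crs ->]; rewrite -rmorphXn -polyC_exp rsQ.
by move=> _ /mapP[c crs ->]; apply: Kvar_neqC.
Qed.

Lemma definable_zeros (F : fieldType) (I : finType) (u : I -> nat -> F) :
  (forall i, orbseq (u i)) -> definable F (fun n => forall i, u i n = 0).
Proof. by move=> uP; exists I, u. Qed.

(** Exponents of q start at 1 so that a shift of the exponent of p by less than K can later be
    undone. *)
Lemma definable_sum_powers p K m (e : 'I_m -> nat) (D : nat) (C : int) :
  prime p -> (0 < K)%N -> (0 < D)%N -> ((\sum_j e j) * p < p ^ K)%N ->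
  definable (Kfield p) (fun n => exists s : 'I_m -> nat,
    (D * n)%:Z = C + (\sum_j e j * (p ^ K) ^ (s j).+1)%N%:Z).
Proof.
move=> p_pr K_gt0 D_gt0 Eq; set E := (\sum_j e j)%N in Eq; set t := Kvar p.
have pF := pchar_Kfield p_pr; have q_gt0 : (0 < p ^ K)%N by rewrite expn_gt0 prime_gt0.
have [rs [rsU rsS rsQ rst]] := Kfield_fixed_roots p_pr K_gt0.
have [w wP] := lagrange_weights rsU; rewrite rsS in wP.
have [k [H HP]] := icoef_sum_powers pF K_gt0 (@transc_tofracX _) rsQ wP Eq.
pose M n := `|(D * n)%:Z - C|%N.
(* (x - t)^(D n - C) as a geometric sequence in n. The test for 0 covers elements x outside [rs],
   because the sum lemma asks for all x. *)
pose v x n := if x - t == 0 then 0 else (x - t) ^ (- C) * ((x - t) ^+ D) ^+ n.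
have vO x : orbseq (v x).
  rewrite /v; case: eqP => [_|/eqP xt]; first exact: orbseq_const.
  by apply: orbseq_geom; rewrite ?expfz_neq0 ?expf_neq0.
have vE x n : x \in rs -> C <= (D * n)%:Z -> v x n = (x - t) ^+ M n.
  move=> xrs Cn; rewrite /v (negPf (rst x xrs)) -exprM !exprnP -expfzDr ?rst //.
  by rewrite /M gez0_abs ?subr_ge0 // addrC.
pose ic l n := \sum_(x <- rs) w l x * v x n.
have icO l : orbseq (ic l).
  by apply: orbseq_sum => x; apply: orbseq_mul => //; apply: orbseq_const.
have icE l n : C <= (D * n)%:Z -> ic l n = icoef t rs w l (M n).
  by move=> Cn; apply: eq_big_seq => x xrs; rewrite vE.
(* Ensures that [M n] is D n - C rather than its opposite, and that no term with nonzero coefficient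
   has exponent 0. It is periodic modulo q from |C| on. *)
pose b n := (C <= (D * n)%:Z) && ((p ^ K)%N%:Z %| (D * n)%:Z - C)%Z.
have bD : definable (Kfield p) b.
  apply: (definable_eventually_periodic (Kvar_neq0 p) (Kvar_neq1 p) (n0 := `|C|) q_gt0).
  move=> n Cn; have Cn' i : C <= (D * (n + i))%:Z.
    apply: le_trans (ler_norm C) _; rewrite -abszE lez_nat (leq_trans Cn) //.
    by apply: leq_trans (leq_addr i n) _; rewrite leq_pmull.
  rewrite /b Cn'.
  have := Cn' 0%N; rewrite addn0 => -> /=.
  rewrite mulnDr PoszD addrAC rpredDr // PoszM.
  exact: dvdz_mull.
have ic0D : definable (Kfield p) (fun n => forall l : 'I_(p ^ K),
    (if (E < l)%N then ic l n else 0) = 0).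
  by apply: definable_zeros => l; case: (E < l)%N; [apply: icO|apply: orbseq_const].
have ic1D : definable (Kfield p) (fun n => forall _ : unit, ic E n + -1 = 0).
  by apply: definable_zeros => _; apply: orbseq_add; [apply: icO|apply: orbseq_const].
have HD : definable (Kfield p) (fun n => forall i : 'I_k,
    (H i).@[fun j : 'I_E => (-1) ^+ j.+1 * ic (E - j.+1)%N n] = 0).
  apply: definable_zeros => i.
  apply: (@orbseq_meval _ _ (H i) (fun (j : 'I_E) n => (-1) ^+ j.+1 * ic (E - j.+1)%N n)) => j.
  by apply: orbseq_mul; [apply: orbseq_const|apply: icO].
apply: definable_ext (definable_and bD (definable_and ic0D (definable_and ic1D HD))) => n.
have HP' : C <= (D * n)%:Z ->
    (exists s : 'I_m -> nat, M n = \sum_j e j * (p ^ K) ^ s j)%N <->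
    ((forall l : 'I_(p ^ K), (if (E < l)%N then ic l n else 0) = 0) /\
     (forall _ : unit, ic E n + -1 = 0) /\
     (forall i : 'I_k,
        (H i).@[fun j : 'I_E => (-1) ^+ j.+1 * ic (E - j.+1)%N n] = 0)).
  move=> Cn; apply: iff_trans (HP (M n)) _; split=> [[c0 c1 cH]|[c0 [c1 cH]]].
    split=> [l|]; first by case: ifP => // El; rewrite icE // c0 ?El /=.
    split=> [_|i]; first by rewrite icE // c1 subrr.
    by rewrite -[RHS](cH i); apply: meval_eq => j; rewrite icE.
  split=> [l /andP[El lq]||i].
  - by rewrite -icE // -[RHS](c0 (Ordinal lq)) /= El.
  - by apply/eqP; rewrite -icE // -subr_eq0 c1.
  by rewrite -[RHS](cH i); apply: meval_eq => j; rewrite icE.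
split=> [[/andP[Cn qn] /(HP' Cn) [s Ms]]|[s ns]].
  have MZ : (D * n)%:Z = C + (M n)%:Z by rewrite /M gez0_abs ?subr_ge0 // addrCA subrr addr0.
  (* the terms with [s j = 0] add up to less than [q], and [q] divides [M n] *)
  have low0 : (\sum_(j | s j == 0) e j = 0)%N.
    have : (p ^ K %| \sum_(j | s j == 0) e j)%N.
      have : (p ^ K %| M n)%N by move: qn; rewrite dvdzE.
      rewrite Ms (bigID (fun j => s j == 0%N)) /= dvdn_addl; last first.
        apply: dvdn_sum => j; case: (s j) => // i _.
        by rewrite expnS mulnCA dvdn_mulr.
      by under eq_bigr => j /eqP -> do rewrite expn0 muln1.
    have lt_q : (\sum_(j | s j == 0) e j < p ^ K)%N.
      apply: leq_ltn_trans Eq; apply: (@leq_trans E); last by rewrite leq_pmulr ?prime_gt0.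
      by rewrite /E [leqRHS](bigID (fun j => s j == 0%N)) leq_addr.
    by move=> /dvdn_leq qS; apply/eqP; rewrite -leqn0 leqNgt; apply: contraL lt_q; rewrite -leqNgt.
  exists (fun j => (s j).-1); rewrite MZ Ms; congr (_ + Posz _).
  apply: eq_bigr => j _; case sj: (s j) => [|i] //.
  have /eqP -> : e j == 0%N; last by rewrite !mul0n.
  by rewrite -leqn0 -low0 (bigD1 j) ?sj //= leq_addr.
have Cn : C <= (D * n)%:Z by rewrite ns lerDl.
split; last by apply/(HP' Cn); exists (fun j => (s j).+1); rewrite /M ns addrAC subrr add0r.
rewrite /b Cn ns addrAC subrr add0r dvdzE /=.
by apply: dvdn_sum => j _; rewrite expnS mulnCA dvdn_mulr.
Qed.

(* Rotating finitely many residues modulo [K] so as to free the top [c] ones. *)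
Lemma exists_rotation K m c (r : 'I_m -> 'I_K) : (m * c < K)%N ->
  exists u : 'I_K, forall j, ((r j + u) %% K < K - c)%N.
Proof.
move=> mcK; have K_gt0 : (0 < K)%N by apply: leq_ltn_trans mcK.
(* [f] lists the rotations carrying some residue into a top position; there are at most m c < K of
   them. *)
pose f (ji : 'I_m * 'I_c) : 'I_K :=
  Ordinal (ltn_pmod (K - ji.2.+1 + (K - r ji.1)) K_gt0).
have /subsetPn[u _ uP] : ~~ ([set: 'I_K] \subset f @: [set: 'I_m * 'I_c]).
  apply/negP => /subset_leq_card; rewrite cardsT card_ord leqNgt; apply/negP/negPn.
  by apply: leq_ltn_trans (leq_imset_card _ _) _; rewrite cardsT card_prod !card_ord.
exists u => j; rewrite ltnNge; apply: contra uP => le_v.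
set v := ((r j + u) %% K)%N in le_v; have vK : (v < K)%N by rewrite ltn_mod.
have ic : (K - v.+1 < c)%N by move: le_v vK; lia.
apply/imsetP; exists (j, Ordinal ic) => //; apply/val_inj => /=.
have -> : (K - (K - v.+1).+1 = v)%N by lia.
rewrite /v modnDml.
have -> : (r j + u + (K - r j) = u + K)%N by have := ltn_ord (r j); lia.
by rewrite modnDr modn_small.
Qed.

(** After multiplication by p^u, each exponent k_j n_j + u is split as a residue plus a multiple of
    K. The rotation u keeps the residues below K - c, hence the new coefficients small enough for
    [definable_sum_powers]. *)
Lemma definable_sum_prime_powers p m (e k : 'I_m -> nat) (D : nat) (C : int) :
  prime p -> (forall j, 0 < k j)%N -> (0 < D)%N ->
  definable (Kfield p) (fun n => exists nn : 'I_m -> nat,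
    (D * n)%:Z = C + (\sum_j e j * p ^ (k j * nn j))%N%:Z).
Proof.
move=> p_pr k_gt0 D_gt0; pose c := (\sum_j e j)%N; have p_gt1 := prime_gt1 p_pr.
(* A multiple of every k_j, so that divisibility of an exponent by k_j is read off its residue, and
   larger than m c, as the rotation requires. *)
pose K := ((\prod_j k j) * (m * c).+1)%N.
have K_gt : (m * c < K)%N.
  by rewrite /K leq_pmull // prodn_gt0.
have K_gt0 : (0 < K)%N by apply: leq_ltn_trans K_gt.
have kK j : (k j %| K)%N by rewrite /K (bigD1 j) //= -mulnA dvdn_mulr.
have /fin_all_exists[u uP] (r : {ffun 'I_m -> 'I_K}) := exists_rotation r K_gt.
pose e1 (r : {ffun 'I_m -> 'I_K}) j := (e j * p ^ ((r j + u r) %% K))%N.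
(* [r] records the residues of the k_j n_j, and [J] the indices with k_j n_j + u < K, whose terms
   are constants. *)
pose S (rJ : {ffun 'I_m -> 'I_K} * {set 'I_m}) n :=
  let: (r, J) := rJ in
  [forall j, (k j %| r j) && ((j \in J) ==> (r j + u r < K))]%N /\
  exists s : 'I_m -> nat, (p ^ u r * D * n)%:Z =
    (p ^ u r)%N%:Z * C + (\sum_(j in J) e1 r j)%N%:Z +
    (\sum_j (if j \in J then 0 else e1 r j) * (p ^ K) ^ (s j).+1)%N%:Z.
have SD rJ : definable (Kfield p) (S rJ).
  case: rJ => r J; apply: definable_and; first exact: definable_const.
  apply: definable_sum_powers => //; first by rewrite muln_gt0 expn_gt0 ltnW.
  (* Multiplied by p this is c p^(K - c), which is less than p^K because c < p^c. *)
  have le_e1 : (\sum_j (if j \in J then 0 else e1 r j) <= c * p ^ (K - c).-1)%N.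
    rewrite /c big_distrl leq_sum // => j _; case: ifP => // _.
    by rewrite leq_mul2l leq_exp2l // -ltnS (ltn_predK (uP r j)) uP orbT.
  apply: leq_ltn_trans (leq_mul le_e1 (leqnn p)) _.
  have [c0|c_gt0] := posnP c; first by rewrite c0 !mul0n expn_gt0 ltnW.
  have cK : (c < K)%N.
    apply: leq_ltn_trans K_gt; rewrite leq_pmull //.
    rewrite lt0n; apply: contraTneq c_gt0 => m0; rewrite /c big1 // => j _.
    by have := ltn_ord j; rewrite [X in (_ < X)%N]m0.
  rewrite -mulnA -expnSr prednK ?subn_gt0 // -[X in (_ < p ^ X)%N](subnKC (ltnW cK)).
  by rewrite expnD ltn_pmul2r ?expn_gt0 ?(ltnW p_gt1) // ltn_expl.
apply: definable_ext (definable_exists SD) => n; split.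
  case=> -[r J] [/forallP rP [s ns]].
  pose a j := (if j \in J then r j : nat else (r j + u r) %% K + K * (s j).+1 - u r)%N.
  have aE j : (a j + u r = (r j + u r) %% K + (if j \in J then 0 else K * (s j).+1))%N.
    rewrite /a; have /andP[_ /implyP] := rP j; case: ifP => _; last first.
      by move=> _; rewrite subnK // mulnS; have := ltn_ord (u r); lia.
    by move=> /(_ isT) ruK; rewrite modn_small ?addn0.
  have ka j : (k j %| a j)%N.
    have /andP[kr _] := rP j; rewrite -(dvdn_addl _ (kK j)) //.
    have : (a j + u r == r j + u r %[mod K])%N.
      rewrite aE modnDml; case: ifP => _; rewrite ?addn0 //.
      by rewrite addnC mulnC modnMDl.
    rewrite eqn_modDr => /eqP ar; rewrite dvdn_addl // /dvdn.
    by rewrite -(modn_dvdm _ (kK j)) ar modn_dvdm.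
  exists (fun j => a j %/ k j)%N; apply: (@mulfI _ (p ^ u r)%N%:Z).
    by rewrite eqz_nat -lt0n expn_gt0 ltnW.
  rewrite -PoszM mulnA ns mulrDr -addrA; congr (_ + _).
  rewrite -PoszD -PoszM; congr Posz.
  rewrite [X in (X + _)%N]big_mkcond -big_split big_distrr; apply: eq_bigr => j _ /=.
  rewrite [(k j * _)%N]mulnC divnK // [RHS]mulnCA -expnD [(u r + _)%N]addnC aE expnD.
  by case: ifP => _; rewrite ?mul0n ?addn0 ?muln1 ?add0n -?expnM ?mulnA.
case=> nn nE.
pose r : {ffun 'I_m -> 'I_K} := [ffun j => Ordinal (ltn_pmod (k j * nn j) K_gt0)].
pose J := [set j | k j * nn j + u r < K]%N.
have rE j : r j = (k j * nn j %% K)%N :> nat by rewrite ffunE.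
exists (r, J); split.
  apply/forallP => j; rewrite rE /dvdn modn_dvdm ?kK // -/(dvdn _ _) dvdn_mulr //=.
  by rewrite inE; apply/implyP; apply: leq_ltn_trans; rewrite leq_add2r leq_mod.
exists (fun j => ((k j * nn j + u r) %/ K).-1).
rewrite -mulnA PoszM nE mulrDr -addrA; congr (_ + _).
rewrite -PoszM -PoszD; congr Posz.
rewrite [X in (_ = X + _)%N]big_mkcond -big_split big_distrr; apply: eq_bigr => j _ /=.
rewrite mulnCA -expnD /e1 rE modnDml [(u r + _)%N]addnC inE; case: ltnP => [lt_K|le_K].
  by rewrite modn_small // mul0n addn0.
rewrite add0n prednK ?divn_gt0 // -mulnA -expnM -expnD; congr (_ * _ ^ _)%N.
by rewrite [RHS]addnC [(K * _)%N]mulnC -divn_eq.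
Qed.

Lemma common_denominator m (c : 'I_m -> rat) :
  exists D (e : 'I_m -> int), (0 < D)%N /\ forall j, D%:Q * c j = (e j)%:~R.
Proof.
exists (\prod_j `|denq (c j)|)%N, (fun j => numq (c j) * (\prod_(i | i != j) `|denq (c i)|)%N%:Z).
split=> [|j]; first by rewrite prodn_gt0 // => j; rewrite absz_gt0 denq_neq0.
rewrite (bigD1 j) //= PoszM !rmorphM /= gez0_abs ?denq_ge0 // numqE.
by rewrite mulrAC [X in X * _]mulrC.
Qed.

Lemma definable_pset p (T : nat -> Prop) :
  prime p -> is_pset p T -> definable (Kfield p) T.
Proof.
move=> p_pr [m [c [k [_ [_ TP]]]]].
have [D [e [D_gt0 eP]]] := common_denominator c.
have scale (nn : 'I_m -> nat) :
    D%:Q * (\sum_j c j * p%:Q ^+ (k j * nn j)) = (\sum_j e j * (p ^ (k j * nn j))%N%:Z)%:~R.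
  rewrite mulr_sumr rmorph_sum; apply: eq_bigr => j _.
  by rewrite mulrA eP [RHS]rmorphM /= -!pmulrn natrX.
have D0 : D%:Q != 0 by rewrite intr_eq0 eqz_nat -lt0n.
have TE n : T n <-> exists nn : 'I_m -> nat,
    (D * n)%:Z = \sum_j e j * (p ^ (k j * nn j))%N%:Z.
  have -> : T n <-> in_B p c k n%:Q.
    split=> [Tn|/TP[n' [Tn' /eqP]]]; first by apply/TP; exists n.
    by rewrite eqr_int eqz_nat => /eqP->.
  split=> -[nn nE]; exists nn.
    by apply/eqP; rewrite -(eqr_int rat) -scale -nE PoszM rmorphM.
  by apply: (mulfI D0); rewrite scale -nE PoszM rmorphM.
have sum_ge0 (nn : 'I_m -> nat) : 0 <= \sum_j e j * (p ^ (k j * nn j))%N%:Z.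
  have /TP[n [_ nE]] : in_B p c k (\sum_j c j * p%:Q ^+ (k j * nn j)) by exists nn.
  by rewrite -(ler_int rat) -scale nE mulr_ge0 ?ler0z.
(* Otherwise a large n_j, with the other exponents 0, would give a negative element; n_j = |R| is
   large enough. *)
have e_ge0 j : (0 < k j)%N -> 0 <= e j.
  move=> kj; rewrite leNgt; apply/negP => ej.
  pose R := \sum_(i | i != j) e i.
  have := sum_ge0 (fun i => if i == j then `|R|%N else 0%N).
  rewrite (bigD1 j) //= eqxx.
  under eq_bigr => i ij do rewrite (negPf ij) muln0 expn0 mulr1.
  rewrite -/R leNgt => /negP[].
  have : (`|R| < p ^ (k j * `|R|))%N.
    apply: leq_trans (ltn_expl _ (prime_gt1 p_pr)) _.
    by rewrite leq_exp2l ?prime_gt1 // leq_pmull.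
  move: (p ^ _)%N => P; nia.
(* Terms with k_j = 0 are constant and may be negative. They move into C, leaving coefficient 0 and
   the dummy exponent factor 1. *)
pose e' j := if k j == 0%N then 0%N else `|e j|%N.
pose k' j := if k j == 0%N then 1%N else k j.
have k'_gt0 j : (0 < k' j)%N by rewrite /k'; case: (posnP (k j)).
apply: definable_ext (@definable_sum_prime_powers p m e' k' D
  (\sum_(j | k j == 0%N) e j) p_pr k'_gt0 D_gt0) => n.
apply: iff_trans (iff_sym (TE n)).
have sumE (nn : 'I_m -> nat) : \sum_(j | k j == 0%N) e j +
    (\sum_j e' j * p ^ (k' j * nn j))%N%:Z = \sum_j e j * (p ^ (k j * nn j))%N%:Z.
  rewrite [X in X + _]big_mkcond (big_morph Posz PoszD (erefl _)) -big_split.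
  apply: eq_bigr => j _; rewrite /e' /k'; case: (posnP (k j)) => [->|kj] /=.
    by rewrite !mul0n expn0 mulr1 addr0.
  by rewrite add0r PoszM gez0_abs ?e_ge0.
by split=> -[nn nE]; exists nn; rewrite nE sumE.
Qed.

Theorem theorem1p6 (p : nat) (S : nat -> Prop) :
  prime p ->
  (exists (na : nat) (a b : 'I_na -> nat) (np : nat) (T : 'I_np -> (nat -> Prop)),
      (forall j, is_pset p (T j)) /\
      (forall n : nat, S n <-> (exists i, in_AP (a i) (b i) n) \/ (exists j, T j n))) ->
  exists (k : nat) (Phi : torus_endo (Kfield p) k) (alpha : 'I_k -> Kfield p)
         (V : seq {mpoly (Kfield p)[k]}),
    (0 < k)%N /\ torus_point alpha /\
    forall n : nat, in_subvariety V (iter n (endo_apply Phi) alpha) <-> S n.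
Proof.
move=> p_pr [na [a [b [np [T [Tp SE]]]]]]; apply: definable_subvariety.
apply: definable_ext (fun n => iff_sym (SE n)) _.
apply: definable_or; apply: definable_exists => j; last exact: definable_pset.
exact: definable_in_AP (Kvar_neq0 p) (Kvar_neq1 p).
Qed.
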